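(* Let $p$ be a prime, $n \geq 1$, $k \in \mathbb{Z}_{\geq 1}$, and $A_k := \mathrm{M}_n(\mathbb{Z}/p^k\mathbb{Z})$. Fix $M(t), N(t) \in A_k[t]$. For any $X \in A_k$ there exist unique $U(t) \in A_k[t]$ and unique $X' \in A_k$ such that \[\big(X + I_n t + p I_n t^2 M(t)\big)\, U(t) = X' + I_n t + p I_n t^2 N(t).\] Moreover, $U(t) \in I_n + pA_k[t]$ and $X' \equiv X \pmod p$.
   Context: $A_k[t]$ is the polynomial ring over the (noncommutative) ring $A_k$ in a variable $t$ commuting with $A_k$. *)

(* Defs.v *)
From mathcomp Require Import all_boot all_order all_algebra.

Set Implicit Arguments.
Unset Strict Implicit.
Unset Printing Implicit Defensive.

Import GRing.Theory.
Local Open Scope ring_scope.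

(* A_k = M_n(Z/p^k).  Polynomials need a nontrivial coefficient ring, which
   square matrices form only in sizes m.+1, i.e. n >= 1.  'Z_(p ^ k) is Z/p^k
   only when 1 < p ^ k, hence 0 < k is needed for a prime p. *)
Notation mxZpk p k n := 'M['Z_((p ^ k)%N)]_n.

(* Congruence modulo pR, which is a two-sided ideal as p%:R is central; for
   matrices this is entrywise congruence. *)
Definition congr_mod_p (R : nzRingType) (p : nat) (x y : R) : Prop :=
  exists z : R, x - y = p%:R * z.

(* X + I t + p I t^2 M, with t = 'X (which commutes with the coefficients);
   in a matrix ring 1 is I and p%:R is p I. *)
Definition XtMp (R : nzRingType) (p : nat) (X : R) (M : {poly R}) : {poly R} :=
  X%:P + 1%:P * 'X + (p%:R)%:P * 'X^2 * M.

(* Main.v *)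
(* The linear polynomial X + t is monic, so left division by it works over the
   noncommutative ring A_k.  An error term p^j E in the equation is removed, at
   the price of an error p^(j+1) E', by subtracting p^j times the quotient of E
   from U and adding p^j times the remainder of E to X'.  Since p^k = 0 this
   stops after finitely many steps.  For uniqueness, the difference D of two
   solutions satisfies (X + t + p t^2 M) D = C with C constant; uniqueness of
   the quotient modulo p^j shows inductively that every p^j divides D. *)
Require Import Defs.
From mathcomp Require Import all_boot all_order all_algebra.

Import GRing.Theory.
Local Open Scope ring_scope.

Lemma left_div_XaddC (R : nzRingType) (X : R) (P : {poly R}) :
  exists (Q : {poly R}) (r : R), P = ('X + X%:P) * Q + r%:P.
Proof.
elim/poly_ind: P => [|P c [Q [r ->]]].
  by exists 0, 0; rewrite mulr0 polyC0 addr0.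
(* As ['X] is central, [r%:P * 'X] equals [('X + X%:P) * r%:P - (X * r)%:P]. *)
exists (Q * 'X + r%:P), (c - X * r).
rewrite mulrDr mulrA mulrDl -!addrA; congr (_ + _).
by rewrite mulrDl -commr_polyX -addrA polyCB polyCM [_ - _]addrC addNKr.
Qed.

(** Multiplying a nonzero [Q] by a monic linear factor raises its size by one, to at least 2, which
    no constant has. *)
Lemma left_div_XaddC_eq0 (R : nzRingType) (X C : R) (Q : {poly R}) :
  ('X + X%:P) * Q = C%:P -> Q = 0.
Proof.
move=> eqC; apply/eqP; apply: contraT => Q0.
have := size_polyC_leq1 C; rewrite -eqC size_monicM ?monicXaddC //.
by rewrite size_XaddC /= ltnS leqn0 size_poly_eq0 (negPf Q0).
Qed.

Lemma XtMpE (R : nzRingType) (p : nat) (X : R) (M : {poly R}) :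
  XtMp p X M = 'X + X%:P + ('X^2 * M) *+ p.
Proof. by rewrite /XtMp mul1r -mulrA polyC_natr mulr_natl [_ + 'X]addrC. Qed.

Lemma XtMp_quotient_eq0 (R : nzRingType) (p k : nat) (X C : R)
    (M D : {poly R}) :
  (forall P : {poly R}, P *+ p ^ k = 0) -> XtMp p X M * D = C%:P -> D = 0.
Proof.
move=> pk0 eqC; suff /(_ k)[E ->] : forall j, exists E, D = E *+ p ^ j by [].
elim=> [|j [E defD]]; first by exists D; rewrite expn0.
have [Q [r defE]] := left_div_XaddC _ X ('X^2 * M * E).
(* Dividing the [p]-term of the equation turns it into [('X + X%:P) * (D + Q *+ p ^ j.+1) = (C - r
   *+ p ^ j.+1)%:P], so the second factor vanishes. *)
exists (- Q); apply/eqP; rewrite -subr_eq0 mulNrn opprK; apply/eqP.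
apply: (left_div_XaddC_eq0 _ X (C - r *+ p ^ j.+1)).
rewrite polyCB polyCMn -eqC XtMpE.
rewrite [LHS]mulrDr [(_ + _ *+ p) * D]mulrDl -addrA; congr (_ + _).
rewrite [in RHS]defD mulrnAl !mulrnAr -mulrnA -expnSr defE.
by rewrite mulrnDl addrK.
Qed.

(** All corrections are kept as multiples of [p], so that both congruences come with the
    solution. *)
Lemma XtMp_solve_mod (R : nzRingType) (p : nat) (X : R) (M N : {poly R})
    (j : nat) :
  exists (V : {poly R}) (z : R) (E : {poly R}),
    XtMp p X M * (1 + V *+ p) = XtMp p (X + z *+ p) N + E *+ p ^ j.+1.
Proof.
elim: j => [|j [V [z [E eqE]]]].
  exists 0, 0, ('X^2 * M - 'X^2 * N).
  by rewrite !mul0rn !addr0 mulr1 !XtMpE expn1 mulrnBl addrA addrAC addrK.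
have [Q [r defE]] := left_div_XaddC _ X E.
(* The new error is what the [p]-term of [XtMp p X M] makes of [- Q *+ p ^ j.+1], hence the extra
   factor [p]. *)
exists (V - Q *+ p ^ j), (z + r *+ p ^ j), (- ('X^2 * M * Q)).
rewrite mulrnBl addrA mulrBr eqE defE -mulrnA -expnSr mulrnAr !XtMpE.
rewrite mulrnDl [in X in _ - X]mulrDl mulrnDl opprD mulrnAl -mulrnA -expnS.
rewrite mulNrn !addrA; congr (_ - _).
rewrite mulrnDl -mulrnA -expnSr !polyCD !polyCMn.
rewrite -!addrA; do 3!congr (_ + _).
by rewrite [r%:P *+ _ - _]addrC addNKr addrC.
Qed.

Lemma XtMp_factorization (R : nzRingType) (p k : nat) (M N : {poly R}) (X : R) :
  (forall x : R, x *+ p ^ k = 0) ->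
  exists (U : {poly R}) (X' : R),
    [/\ XtMp p X M * U = XtMp p X' N,
        forall (V : {poly R}) (Y : R),
          XtMp p X M * V = XtMp p Y N -> V = U /\ Y = X',
        exists V : {poly R}, U = 1 + p%:R * V
      & congr_mod_p p X' X].
Proof.
move=> pk0.
have Ppk0 (P : {poly R}) : P *+ p ^ k = 0.
  by apply/polyP=> i; rewrite coefMn coef0 pk0.
have [V [z [E eqU]]] := XtMp_solve_mod _ p X M N k.
rewrite expnSr mulrnA Ppk0 mul0rn addr0 in eqU.
exists (1 + V *+ p), (X + z *+ p); split=> //.
- move=> W Y eqW.
  (* Both right-hand sides share ['X] and the [N] term, so their difference is constant. *)
  have eqD : XtMp p X M * (W - (1 + V *+ p)) = (Y - (X + z *+ p))%:P.
    rewrite mulrBr eqW eqU !XtMpE polyCB opprD addrACA subrr addr0.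
    by rewrite opprD addrACA subrr add0r.
  have /eqP D0 := XtMp_quotient_eq0 _ _ _ _ _ _ _ Ppk0 eqD.
  split; first by apply/eqP; rewrite -subr_eq0.
  move: eqD; rewrite (eqP D0) mulr0 => /esym/eqP.
  by rewrite polyC_eq0 subr_eq0 => /eqP.
- by exists V; rewrite mulr_natl.
- by exists z; rewrite mulr_natl addrC addKr.
Qed.

Theorem theorem5p7 (p : nat) (p_prime : prime p) (m k : nat) (k_gt0 : (0 < k)%N)
    (M N : {poly mxZpk p k m.+1}) (X : mxZpk p k m.+1) :
  exists (U : {poly mxZpk p k m.+1}) (X' : mxZpk p k m.+1),
    [/\ XtMp p X M * U = XtMp p X' N,
        forall (V : {poly mxZpk p k m.+1}) (Y : mxZpk p k m.+1),
          XtMp p X M * V = XtMp p Y N -> V = U /\ Y = X',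
        exists V : {poly mxZpk p k m.+1}, U = 1 + p%:R * V
      & congr_mod_p p X' X].
Proof.
apply: (XtMp_factorization _ p k) => A; apply/matrixP=> i j.
have pk_gt1 : (1 < p ^ k)%N by rewrite -(exp1n k) ltn_exp2r ?prime_gt1.
by rewrite mulmxnE mxE -mulr_natl pchar_Zp ?mul0r.
Qed.
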